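(* Let $(E,g)$ be a semi-Riemannian Lie algebroid over $M$ with anchor $\alpha$, and let $K\subset E$ be the kernel of $g$. A Koszul derivative $D$ on $(E,g)$ exists if and only if $$\mathcal{L}_Ug=0\quad\text{for all }U\in\mathrm{Sec}(K).$$ In the latter case $D$ is uniquely determined, up to the identification of $E/K$ with a subbundle of $E$ complementary to $K$ (that is, $D_XY$ is uniquely determined modulo $K$, hence uniquely determined once it is required to take values in a fixed subbundle complementary to $K$), by the Koszul formula $$2g(D_XY,Z)=\alpha(X)g(Y,Z)+\alpha(Y)g(Z,X)-\alpha(Z)g(X,Y)+g([X,Y],Z)-g([Y,Z],X)-g([X,Z],Y)$$ for all $X,Y,Z\in\mathrm{Sec}(E)$.
   Context: A semi-Riemannian Lie algebroid $(E,g)$ is a Lie algebroid $E\to M$ (with bracket $[\cdot,\cdot]$ on $\mathrm{Sec}(E)$ and anchor $\alpha:E\to TM$) together with a symmetric 2-form $g$ on $E$ (a section of $E^\ast\odot E^\ast$) whose kernel $K=\{X\in E: g(X,\cdot)=0\}$ is a constant-rank subbundle of $E$. No positivity is required. The Lie derivative of $g$ along $U\in\mathrm{Sec}(E)$ is $(\mathcal{L}_Ug)(X,Y)=\alpha(U)g(X,Y)-g([U,X],Y)-g(X,[U,Y])$. A Koszul derivative on $(E,g)$ is an $\mathbb{R}$-bilinear map $D:\mathrm{Sec}(E)\times\mathrm{Sec}(E)\to\mathrm{Sec}(E)$, $(X,Y)\mapsto D_XY$, such that for all $X,Y,Z,W\in\mathrm{Sec}(E)$ and $f\in C^\infty(M)$: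 (a) $g(D_{fX}Z,W)=f\,g(D_XZ,W)$; (b) $g(D_X(fY),W)=\alpha(X)(f)\,g(Y,W)+f\,g(D_XY,W)$; (c) $\alpha(Z)g(X,Y)=g(D_ZX,Y)+g(X,D_ZY)$; (d) $g(D_XY,W)-g(D_YX,W)=g([X,Y],W)$. *)

(* Defs.v *)
(* The real numbers are an arbitrary [R : realType] of MathComp-Analysis. *)
From HB Require Import structures.
From mathcomp Require Export all_boot all_order all_algebra.
From mathcomp Require Export sesquilinear.
From mathcomp Require Export all_classical all_reals all_analysis.

Set Implicit Arguments.
Unset Strict Implicit.
Unset Printing Implicit Defensive.

Import Order.TTheory GRing.Theory Num.Theory.
Import numFieldNormedType.Exports.

Local Open Scope classical_set_scope.
Local Open Scope ring_scope.

Lemma near_eq_differentiable (R : numFieldType) (V W : normedModType R)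
  (f h : V -> W) (x : V) :
  {near x, f =1 h} -> differentiable f x -> differentiable h x.
Proof.
move=> fh df.
have hE : h \o shift x = cst (h x) + 'd f x +o_ 0 id.
  apply/eqaddoP => _/posnumP[e].
  have /eqaddoP /(_ e%:num (gt0 _)) := diff_locally df.
  move: fh (nbhs_singleton fh); rewrite (near_shift 0) subr0 => fh fhx.
  by apply: filterS2 fh => y /= fhy; rewrite !fctE /= fhy fhx.
have dE := diff_unique (diff_continuous df) hE.
by apply/diff_locallyP; rewrite dE; split=> //; exact: diff_continuous.
Qed.

Section Ck.
Context {R : realType} {n : nat}.
Implicit Types (U V : set 'rV[R]_n) (f h : 'rV[R]_n -> R).

(* Meant for [U] open.  [f] is C^k.+1 when its Frechet derivative exists on [U]
   and is C^k; as R^n is finite-dimensional the latter can be tested on each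
   fixed vector [v]. *)
Fixpoint Ck_on (k : nat) U f : Prop :=
  match k with
  | 0%N => forall x, U x -> {for x, continuous f}
  | k'.+1 => (forall x, U x -> differentiable f x) /\
             (forall v, Ck_on k' U (fun x => 'D_v f x))
  end.

Definition Coo_on U f : Prop := forall k, Ck_on k U f.

Lemma Ck_on_sub k U V f : V `<=` U -> Ck_on k U f -> Ck_on k V f.
Proof.
elim: k f => [|k IH] f VU /=; first by move=> cf x /VU /cf.
by case=> df Df; split=> [x /VU /df //|v]; exact: IH.
Qed.

Lemma Ck_on_local k U f :
  (forall x, U x -> exists2 V, V x & Ck_on k V f) -> Ck_on k U f.
Proof.
elim: k f => [|k IH] f loc /=.
  by move=> x /loc[V Vx]; exact.
split=> [x /loc[V Vx [+ _]]|v]; first exact.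
by apply: IH => x /loc[V Vx [_ /(_ v)]]; exists V.
Qed.

Lemma Ck_on_cst k U (c : R) : Ck_on k U (fun=> c).
Proof.
elim: k c => [|k IH] c.
  by move=> x _; exact: (@cst_continuous _ _ c x).
split=> [x _|v].
  exact: (@differentiable_cst _ _ _ c x).
suff -> : (fun x : 'rV[R]_n => 'D_v (fun=> c) x) = fun=> 0 by exact: IH.
by apply/funext => x; exact: derive_cst.
Qed.

Lemma Ck_on_ext k U f h : open U -> (forall x, U x -> f x = h x) ->
  Ck_on k U f -> Ck_on k U h.
Proof.
move=> oU; elim: k f h => [|k IH] f h fh.
  move=> cf x Ux; have fhx : {near x, f =1 h}.
    by apply: filterS (open_nbhs_nbhs (conj oU Ux)) => y; exact: fh.
  have : f @ x --> f x by exact: cf.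
  rewrite /prop_for /continuous_at -(fh x Ux); apply: cvg_trans.
  exact: (@near_eq_cvg _ _ (nbhs x) (nbhs_filter x)).
have fhx x : U x -> {near x, f =1 h}.
  by move=> Ux; apply: filterS (open_nbhs_nbhs (conj oU Ux)) => y; exact: fh.
move=> [df Df]; split=> [x Ux|v].
  by apply: near_eq_differentiable (df x Ux); exact: fhx.
by apply: (IH _ _ _ (Df v)) => x Ux; apply: near_eq_derive; exact: fhx.
Qed.

Lemma Ck_onS k U f : Ck_on k.+1 U f -> Ck_on k U f.
Proof.
elim: k f => [|k IH] f [df Df].
  by move=> x /df; exact: differentiable_continuous.
by split=> // v; exact: IH.
Qed.

Lemma Ck_onD k U f h : open U ->
  Ck_on k U f -> Ck_on k U h -> Ck_on k U (fun x => f x + h x).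
Proof.
move=> oU; elim: k f h => [|k IH] f h.
  by move=> cf ch x Ux; apply: continuousD; [exact: cf|exact: ch].
move=> [df Df] [dh Dh]; split=> [x Ux|v].
  by apply: differentiableD; [exact: df|exact: dh].
apply: (Ck_on_ext oU _ (IH _ _ (Df v) (Dh v))) => x Ux.
by rewrite -deriveD //; apply: diff_derivable; [exact: df|exact: dh].
Qed.

Lemma Ck_onM k U f h : open U ->
  Ck_on k U f -> Ck_on k U h -> Ck_on k U (fun x => f x * h x).
Proof.
move=> oU; elim: k f h => [|k IH] f h.
  by move=> cf ch x Ux; apply: continuousM; [exact: cf|exact: ch].
move=> Cf Ch; have [df Df] := Cf; have [dh Dh] := Ch; split=> [x Ux|v].
  by apply: differentiableM; [exact: df|exact: dh].
have C1 := IH _ _ (Ck_onS Cf) (Dh v); have C2 := IH _ _ (Ck_onS Ch) (Df v).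
apply: (Ck_on_ext oU _ (Ck_onD oU C1 C2)) => x Ux.
by rewrite deriveM //; apply: diff_derivable; [exact: df|exact: dh].
Qed.

End Ck.

Record chart (R : realType) (n : nat) (T : topologicalType) := Chart {
  chart_dom : set T;
  chart_map :> T -> 'rV[R]_n;
  chart_inv : 'rV[R]_n -> T;
  chart_dom_open : open chart_dom;
  chart_cod_open : open (chart_map @` chart_dom);
  chart_mapK : {in chart_dom, cancel chart_map chart_inv};
  chart_map_continuous : {in chart_dom, continuous chart_map};
  chart_inv_continuous : {in chart_map @` chart_dom, continuous chart_inv}
}.

(* The atlas need not be maximal. *)
Record smoothManifold (R : realType) (n : nat) := SmoothManifold {
  mf_space :> topologicalType;
  mf_hausdorff : hausdorff_space mf_space;
  mf_second_countable : @second_countable mf_space;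
  atlas : set (chart R n mf_space);
  atlas_cover : forall x, exists2 c, atlas c & chart_dom c x;
  atlas_compat : forall c c', atlas c -> atlas c' -> forall j,
    Coo_on (c @` (chart_dom c `&` chart_dom c'))
           (fun u => c' (chart_inv c u) ord0 j)
}.

Section SmoothFunctions.
Context {R : realType} {n : nat} (M : smoothManifold R n).
Implicit Types (U V : set M) (f h : M -> R).

(* Meant for [U] open, as is [smooth_section_on] below. *)
Definition smooth_on U f : Prop :=
  forall c, atlas c ->
    Coo_on (c @` (chart_dom c `&` U)) (fun u => f (chart_inv c u)).

Lemma chart_image_open (c : chart R n M) U :
  open U -> open (c @` (chart_dom c `&` U)).
Proof.
move=> oU; rewrite openE => _ [x [cx Ux] <-].
have icx : (c @` chart_dom c) (c x) by exists x.
have N1 : nbhs (c x) (c @` chart_dom c).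
  by apply: open_nbhs_nbhs; split=> //; exact: chart_cod_open.
have N2 : nbhs (c x) (chart_inv c @^-1` U).
  apply: (chart_inv_continuous (mem_set icx)).
  by rewrite /= chart_mapK ?inE//; exact: open_nbhs_nbhs.
apply: filterS2 N1 N2 => u [y cy <-] /=.
by rewrite chart_mapK ?inE // => Uy; exists y.
Qed.

Lemma smooth_on_sub U V f : V `<=` U -> smooth_on U f -> smooth_on V f.
Proof.
move=> VU sf c ac k; apply: Ck_on_sub (sf c ac k).
by move=> _ [x [cx /VU Ux] <-]; exists x.
Qed.

Lemma smooth_on_local U f :
  (forall x, U x -> exists2 V, V x & smooth_on V f) -> smooth_on U f.
Proof.
move=> loc c ac k; apply: Ck_on_local => _ [x [cx Ux] <-].
have [V Vx sf] := loc x Ux.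
by exists (c @` (chart_dom c `&` V)); [exists x|exact: sf].
Qed.

Lemma smooth_on_cst U (a : R) : smooth_on U (fun=> a).
Proof. by move=> c _ k; exact: Ck_on_cst. Qed.

Lemma smooth_on_ext U f h : open U -> (forall x, U x -> f x = h x) ->
  smooth_on U f -> smooth_on U h.
Proof.
move=> oU fh sf c ac k.
apply: Ck_on_ext (sf c ac k); first exact: chart_image_open.
by move=> _ [x [cx Ux] <-]; rewrite chart_mapK ?inE //; exact: fh.
Qed.

Lemma smooth_onD U f h : open U ->
  smooth_on U f -> smooth_on U h -> smooth_on U (fun x => f x + h x).
Proof.
move=> oU sf sh c ac k.
by apply: Ck_onD; [exact: chart_image_open|exact: sf|exact: sh].
Qed.

Lemma smooth_onM U f h : open U ->
  smooth_on U f -> smooth_on U h -> smooth_on U (fun x => f x * h x).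
Proof.
move=> oU sf sh c ac k.
by apply: Ck_onM; [exact: chart_image_open|exact: sf|exact: sh].
Qed.

Lemma smooth_on_sum U (I : Type) (r : seq I) (F : I -> M -> R) : open U ->
  (forall i, smooth_on U (F i)) -> smooth_on U (fun x => \sum_(i <- r) F i x).
Proof.
move=> oU sF; elim: r => [|i r IH].
  by apply: smooth_on_ext (smooth_on_cst U 0) => // x _; rewrite big_nil.
by apply: smooth_on_ext (smooth_onD oU (sF i) IH) => // x _; rewrite big_cons.
Qed.

Definition smooth_fun : {pred M -> R} := fun f => `[< smooth_on setT f >].

Lemma smooth_fun_subring_closed : subring_closed smooth_fun.
Proof.
split=> [|f h /asboolP sf /asboolP sh|f h /asboolP sf /asboolP sh];
  apply/asboolP.
- exact: smooth_on_cst.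
- apply: (smooth_on_ext openT _
    (smooth_onD openT sf (smooth_onM openT (smooth_on_cst _ (-1)) sh))).
  by move=> x _; rewrite !fctE mulN1r.
- exact: smooth_onM openT sf sh.
Qed.
HB.instance Definition _ :=
  GRing.isSubringClosed.Build (M -> R) smooth_fun smooth_fun_subring_closed.

Lemma smooth_fun_scaler_closed : GRing.scaler_closed smooth_fun.
Proof.
move=> a f /asboolP sf; apply/asboolP.
exact: smooth_onM openT (smooth_on_cst _ a) sf.
Qed.
HB.instance Definition _ :=
  GRing.isScaleClosed.Build R (M -> R) smooth_fun smooth_fun_scaler_closed.

Record Cinf := MkCinf { cinf_fun :> M -> R; cinf_funP : cinf_fun \in smooth_fun }.
HB.instance Definition _ := [isSub for cinf_fun].
HB.instance Definition _ := [Choice of Cinf by <:].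
HB.instance Definition _ := GRing.SubChoice_isSubComPzRing.Build (M -> R)
  smooth_fun Cinf (GRing.subringClosedP _).
HB.instance Definition _ := [SubZmodule_isSubLmodule of Cinf by <:].

Lemma cinf_smooth (f : Cinf) : smooth_on setT f.
Proof. exact/asboolP/cinf_funP. Qed.

Definition mkCinf f (sf : smooth_on setT f) : Cinf := MkCinf (introT (asboolP _) sf).

End SmoothFunctions.

Local Obligation Tactic := idtac.

(* A tangent vector at x is a derivation at x of the algebra of globally defined
   smooth functions. *)

Section Tangent.
Context {R : realType} {n : nat} (M : smoothManifold R n) (x : M).

Record tangent := Tangent {
  tg_fun :> Cinf M -> R;
  tg_linear : scalar tg_fun;
  tg_leibniz : forall f h : Cinf M, tg_fun (f * h) = f x * tg_fun h + h x * tg_fun f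
}.

Lemma tangentP (u v : tangent) : (forall f, u f = v f) -> u = v.
Proof.
case: u v => [u ul uL] [v vl vL] /= /funext uv; case: _ / uv in vl vL *.
by congr Tangent; exact: Prop_irrelevance.
Qed.

HB.instance Definition _ := gen_eqMixin tangent.
HB.instance Definition _ := gen_choiceMixin tangent.

Program Definition tg_zero : tangent := @Tangent (fun=> 0) _ _.
Next Obligation. by move=> a f h; rewrite mulr0 addr0. Qed.
Next Obligation. by move=> f h; rewrite !mulr0 addr0. Qed.
Program Definition tg_add (u v : tangent) : tangent :=
  @Tangent (fun f => u f + v f) _ _.
Next Obligation.
by move=> u v a f h; rewrite /= !tg_linear mulrDr addrACA.
Qed.
Next Obligation.
by move=> u v f h; rewrite /= !tg_leibniz !mulrDr addrACA.
Qed.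
Program Definition tg_scale (a : R) (u : tangent) : tangent :=
  @Tangent (fun f => a * u f) _ _.
Next Obligation.
by move=> b u a f h; rewrite /= tg_linear mulrDr !mulrA (mulrC b a).
Qed.
Next Obligation.
by move=> b u f h; rewrite /= tg_leibniz mulrDr; congr (_ + _); rewrite mulrCA.
Qed.

Fact tg_addA : associative tg_add.
Proof. by move=> u v w; apply: tangentP => f /=; rewrite addrA. Qed.
Fact tg_addC : commutative tg_add.
Proof. by move=> u v; apply: tangentP => f /=; rewrite addrC. Qed.
Fact tg_add0 : left_id tg_zero tg_add.
Proof. by move=> u; apply: tangentP => f /=; rewrite add0r. Qed.
Fact tg_addN : left_inverse tg_zero (tg_scale (-1)) tg_add.
Proof. by move=> u; apply: tangentP => f /=; rewrite mulN1r addNr. Qed.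
HB.instance Definition _ :=
  GRing.isZmodule.Build tangent tg_addA tg_addC tg_add0 tg_addN.

Fact tg_scaleA a b (u : tangent) : tg_scale a (tg_scale b u) = tg_scale (a * b) u.
Proof. by apply: tangentP => f /=; rewrite mulrA. Qed.
Fact tg_scale1 : left_id 1 tg_scale.
Proof. by move=> u; apply: tangentP => f /=; rewrite mul1r. Qed.
Fact tg_scaleDr : right_distributive tg_scale +%R.
Proof. by move=> a u v; apply: tangentP => f /=; rewrite mulrDr. Qed.
Fact tg_scaleDl (u : tangent) : {morph tg_scale^~ u : a b / a + b}.
Proof. by move=> a b; apply: tangentP => f /=; rewrite mulrDl. Qed.
HB.instance Definition _ :=
  GRing.Zmodule_isLmodule.Build R tangent tg_scaleA tg_scale1 tg_scaleDr tg_scaleDl.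

End Tangent.

(* The smooth structure is carried by an atlas of local frames: a local frame on
   an open set U is the same thing as a trivialization of the bundle over U. *)
Record localFrame (R : realType) (r : nat) (T : topologicalType)
    (E : T -> vectType R) := LocalFrame {
  frame_dom : set T;
  frame_vec :> forall x : T, r.-tuple (E x);
  frame_dom_open : open frame_dom;
  frame_basis : forall x, frame_dom x -> basis_of fullv (frame_vec x)
}.

Record vectorBundle (R : realType) (n : nat) (M : smoothManifold R n) (r : nat) :=
  VectorBundle {
  fiber :> M -> vectType R;
  frames : set (localFrame r fiber);
  frames_cover : forall x, exists2 e, frames e & frame_dom e x;
  frames_compat : forall e e', frames e -> frames e' -> forall i j,
    smooth_on (frame_dom e `&` frame_dom e')
              (fun x => coord (e x) i (tnth (e' x) j))
}.

Section Sections.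
Context {R : realType} {n : nat} {M : smoothManifold R n} {r : nat}.
Variable E : vectorBundle M r.

Definition smooth_section_on (U : set M) (s : forall x, E x) : Prop :=
  forall e, frames e -> forall i,
    smooth_on (frame_dom e `&` U) (fun x => coord (e x) i (s x)).

Record Sec := MkSec {
  sec_fun :> forall x, E x;
  sec_smooth : smooth_section_on setT sec_fun
}.

Lemma secP (X Y : Sec) : (forall x, X x = Y x) -> X = Y.
Proof.
case: X Y => [X sX] [Y sY] /= XY.
have {}XY := functional_extensionality_dep XY.
by case: _ / XY in sY *; congr MkSec; exact: Prop_irrelevance.
Qed.

HB.instance Definition _ := gen_eqMixin Sec.
HB.instance Definition _ := gen_choiceMixin Sec.

Fact frame_domT_open (e : localFrame r E) : open (frame_dom e `&` setT).
Proof. by rewrite setIT; exact: frame_dom_open. Qed.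

Program Definition sec_zero : Sec := @MkSec (fun=> 0) _.
Next Obligation.
move=> e _ i.
apply: (smooth_on_ext (frame_domT_open e) _ (smooth_on_cst _ 0)) => x _.
by rewrite linear0.
Qed.
Program Definition sec_add (X Y : Sec) : Sec := @MkSec (fun x => X x + Y x) _.
Next Obligation.
move=> X Y e fe i; have oe := frame_domT_open e.
apply: (smooth_on_ext oe _
  (smooth_onD oe (sec_smooth X fe i) (sec_smooth Y fe i))) => x _.
by rewrite linearD.
Qed.
Program Definition sec_mul (f : Cinf M) (X : Sec) : Sec :=
  @MkSec (fun x => f x *: X x) _.
Next Obligation.
move=> f X e fe i; have oe := frame_domT_open e.
have sf : smooth_on (frame_dom e `&` setT) f.
  exact: smooth_on_sub (@subsetT _ _) (cinf_smooth f).
apply: (smooth_on_ext oe _ (smooth_onM oe sf (sec_smooth X fe i))) => x _.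
by rewrite linearZ.
Qed.
Definition sec_scale (a : R) (X : Sec) : Sec :=
  sec_mul (mkCinf (smooth_on_cst [set: M] a)) X.

Fact sec_addA : associative sec_add.
Proof. by move=> X Y Z; apply: secP => x /=; rewrite addrA. Qed.
Fact sec_addC : commutative sec_add.
Proof. by move=> X Y; apply: secP => x /=; rewrite addrC. Qed.
Fact sec_add0 : left_id sec_zero sec_add.
Proof. by move=> X; apply: secP => x /=; rewrite add0r. Qed.
Fact sec_addN : left_inverse sec_zero (sec_scale (-1)) sec_add.
Proof. by move=> X; apply: secP => x /=; rewrite scaleN1r addNr. Qed.
HB.instance Definition _ :=
  GRing.isZmodule.Build Sec sec_addA sec_addC sec_add0 sec_addN.

Fact sec_scaleA a b (X : Sec) : sec_scale a (sec_scale b X) = sec_scale (a * b) X.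
Proof. by apply: secP => x /=; rewrite scalerA. Qed.
Fact sec_scale1 : left_id 1 sec_scale.
Proof. by move=> X; apply: secP => x /=; rewrite scale1r. Qed.
Fact sec_scaleDr : right_distributive sec_scale +%R.
Proof. by move=> a X Y; apply: secP => x /=; rewrite scalerDr. Qed.
Fact sec_scaleDl (X : Sec) : {morph sec_scale^~ X : a b / a + b}.
Proof. by move=> a b; apply: secP => x /=; rewrite scalerDl. Qed.
HB.instance Definition _ :=
  GRing.Zmodule_isLmodule.Build R Sec sec_scaleA sec_scale1 sec_scaleDr sec_scaleDl.

(* The rank k is the same at all points, also when M is disconnected. *)
Definition is_subbundle (V : forall x, {vspace E x}) : Prop :=
  exists k : nat, forall x0 : M, exists (U : set M) (s : 'I_k -> forall x, E x),
    [/\ open U, U x0, (forall i, smooth_section_on U (s i)) &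
        forall x, U x -> basis_of (V x) [tuple s i x | i < k]].

Definition sec_in (V : forall x, {vspace E x}) (X : Sec) : Prop :=
  forall x, X x \in V x.

Definition complementary (V W : forall x, {vspace E x}) : Prop :=
  forall x, (V x + W x)%VS = fullv /\ (V x :&: W x)%VS = 0%VS.

Lemma sec_coordE (X : Sec) (e : localFrame r E) x : frame_dom e x ->
  X x = \sum_(i < r) coord (e x) i (X x) *: tnth (e x) i.
Proof.
move=> ex; have := coord_basis (frame_basis ex) (memvf (X x)).
by move=> {1}->; apply: eq_bigr => i _; rewrite -tnth_nth.
Qed.

Lemma smooth_frames (f : M -> R) :
  (forall e : localFrame r E, frames e -> smooth_on (frame_dom e) f) ->
  smooth_on setT f.
Proof.
move=> sf; apply: smooth_on_local => x _; have [e fe ex] := frames_cover E x.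
by exists (frame_dom e) => //; exact: sf.
Qed.

Lemma sec_coord_smooth (X : Sec) (e : localFrame r E) i : frames e ->
  smooth_on (frame_dom e) (fun x => coord (e x) i (X x)).
Proof. by move=> /(sec_smooth X)/(_ i); rewrite setIT. Qed.

End Sections.
Notation "f *s X" := (sec_mul f X) (at level 40, X at level 39) : ring_scope.

(* A vector bundle with a bundle map to TM.  A vector field is smooth when it
   maps smooth functions to smooth functions, and a bundle map is smooth when it
   maps local frames to smooth vector fields. *)
Record anchoredBundle (R : realType) (n : nat) (M : smoothManifold R n) (r : nat) :=
  AnchoredBundle {
  ab_bundle :> vectorBundle M r;
  anchor : forall x, {linear ab_bundle x -> tangent x};
  anchor_smooth : forall e : localFrame r ab_bundle, frames e ->
    forall (i : 'I_r) (f : Cinf M),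
      smooth_on (frame_dom e) (fun x => anchor x (tnth (e x) i) f)
}.

Section AnchorAction.
Context {R : realType} {n : nat} {M : smoothManifold R n} {r : nat}.
Variable E : anchoredBundle M r.

Lemma tangent_sumE (x : M) (I : Type) (s : seq I) (F : I -> tangent x) (f : Cinf M) :
  (\sum_(i <- s) F i) f = \sum_(i <- s) F i f.
Proof. by elim: s => [|i s IH]; rewrite ?big_nil // !big_cons -IH. Qed.

Lemma anchor_act_smooth (X : Sec E) (f : Cinf M) :
  smooth_on setT (fun x => anchor E x (X x) f).
Proof.
apply: (@smooth_frames _ _ _ _ E) => e fe; have oe := frame_dom_open e.
have sm i := smooth_onM oe (sec_coord_smooth X i fe) (anchor_smooth fe i f).
apply: (smooth_on_ext oe _ (smooth_on_sum (index_enum _) oe sm)) => x ex.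
rewrite [in RHS](sec_coordE X ex) linear_sum tangent_sumE.
by apply: eq_bigr => i _; rewrite linearZ.
Qed.

Definition anchor_act (X : Sec E) (f : Cinf M) : Cinf M :=
  mkCinf (anchor_act_smooth X f).

End AnchorAction.
Notation "X '·' f" := (anchor_act X f) (at level 40, f at level 39) : ring_scope.

(* That the anchor maps brackets to commutators of vector fields follows from
   the Leibniz rule and the Jacobi identity. *)
Record lieAlgebroid (R : realType) (n : nat) (M : smoothManifold R n) (r : nat) :=
  LieAlgebroid {
  la_bundle :> anchoredBundle M r;
  lie : Sec la_bundle -> Sec la_bundle -> Sec la_bundle;
  lie_linearl : forall Y, linear (lie^~ Y);
  lie_linearr : forall X, linear (lie X);
  lie_alt : forall X, lie X X = 0;
  lie_jacobi : forall X Y Z,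
    lie X (lie Y Z) + lie Y (lie Z X) + lie Z (lie X Y) = 0;
  lie_leibniz : forall X (f : Cinf M) Y,
    lie X (f *s Y) = f *s lie X Y + (X · f) *s Y
}.
Notation "'⟦' X , Y '⟧'" := (lie X Y) (at level 0) : ring_scope.

(* [orthov (g x) fullv] is the space of all u with g x u v = 0 for every v. *)
Definition ker_form (R : realType) (n : nat) (M : smoothManifold R n) (r : nat)
    (E : vectorBundle M r) (g : forall x, {symmetric (E x)}) (x : M) :
  {vspace E x} := orthov (g x) fullv.

Record semiRiemannian (R : realType) (n : nat) (M : smoothManifold R n) (r : nat)
    (E : lieAlgebroid M r) := SemiRiemannian {
  metric : forall x, {symmetric (E x)};
  metric_smooth : forall e : localFrame r E, frames e -> forall i j : 'I_r,
    smooth_on (frame_dom e)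
              (fun x => metric x (tnth (e x) i) (tnth (e x) j));
  metric_ker_subbundle : is_subbundle (ker_form metric)
}.

Section Koszul.
Context {R : realType} {n : nat} {M : smoothManifold R n} {r : nat}.
Context {E : lieAlgebroid M r} (g : semiRiemannian E).
Implicit Types X Y Z W U : Sec E.

Definition metric_ker (x : M) : {vspace E x} := ker_form (metric g) x.

Lemma metric_kerP x (u : E x) :
  u \in metric_ker x <-> forall v, metric g x u v = 0.
Proof.
split=> [/mem_orthovP uK v|uK]; first by apply: uK; exact: memvf.
by apply/mem_orthovP => v _; exact: uK.
Qed.

Lemma pair_smooth X Y : smooth_on setT (fun x => metric g x (X x) (Y x)).
Proof.
apply: (@smooth_frames _ _ _ _ E) => e fe; have oe := frame_dom_open e.
have sm i := smooth_on_sum (index_enum _) oe (fun j =>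
  smooth_onM oe (smooth_onM oe (sec_coord_smooth X i fe) (sec_coord_smooth Y j fe))
    (metric_smooth g fe i j)).
apply: (smooth_on_ext oe _ (smooth_on_sum (index_enum _) oe sm)) => x ex.
rewrite [in RHS](sec_coordE X ex) linear_sumlz; apply: eq_bigr => i _.
rewrite [in RHS](sec_coordE Y ex) linear_sumr; apply: eq_bigr => j _.
by rewrite [RHS]linearZr_LR /= [in RHS]linearZl_LR mulrCA mulrA.
Qed.

Definition pair X Y : Cinf M := mkCinf (pair_smooth X Y).

Local Notation "'⟨' X , Y '⟩'" := (pair X Y) : ring_scope.

Definition lie_derivative U X Y : Cinf M :=
  U · ⟨X, Y⟩ - ⟨⟦U, X⟧, Y⟩ - ⟨X, ⟦U, Y⟧⟩.

Record koszul_derivative (D : Sec E -> Sec E -> Sec E) : Prop := {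
  kd_linearl : forall Y, linear (D^~ Y);
  kd_linearr : forall X, linear (D X);
  kd_a : forall (f : Cinf M) X Z W, ⟨D (f *s X) Z, W⟩ = f * ⟨D X Z, W⟩;
  kd_b : forall (f : Cinf M) X Y W,
    ⟨D X (f *s Y), W⟩ = (X · f) * ⟨Y, W⟩ + f * ⟨D X Y, W⟩;
  kd_c : forall X Y Z, Z · ⟨X, Y⟩ = ⟨D Z X, Y⟩ + ⟨X, D Z Y⟩;
  kd_d : forall X Y W, ⟨D X Y, W⟩ - ⟨D Y X, W⟩ = ⟨⟦X, Y⟧, W⟩
}.

Definition koszul_formula (D : Sec E -> Sec E -> Sec E) : Prop :=
  forall X Y Z,
    ⟨D X Y, Z⟩ *+ 2 =
      X · ⟨Y, Z⟩ + Y · ⟨Z, X⟩ - Z · ⟨X, Y⟩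
      + ⟨⟦X, Y⟧, Z⟩ - ⟨⟦Y, Z⟧, X⟩ - ⟨⟦X, Z⟧, Y⟩.

End Koszul.

(* Main.v *)
(* By polarization a Koszul derivative must satisfy the Koszul formula, and its
   pairing with a section of K vanishes only if L_U g = 0 for all U in Sec(K).
   Conversely, under this hypothesis the right-hand side kappa(X, Y, -) of the
   formula is a tensor vanishing on K.  If S_1, ..., S_m are global sections
   (m = rank E - rank K) with Gram matrix G = (g(S_i, S_j)), then
   V = det G * sum_ij adj(G)_ij kappa(X, Y, S_j) S_i satisfies
   g(V, Z) = (det G)^2 kappa(X, Y, Z) on all of M: where det G does not vanish,
   the S_i span a complement of K.  These local solutions, which stay in any
   subbundle containing the S_i, are glued by a partition of unity. *)
Require Import Defs.
From HB Require Import structures.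
From mathcomp Require Import ring lra.

Set Implicit Arguments.
Unset Strict Implicit.
Unset Printing Implicit Defensive.

Import Order.TTheory GRing.Theory Num.Theory.
Import numFieldNormedType.Exports.

Local Open Scope classical_set_scope.
Local Open Scope ring_scope.

(** * Flat functions of one real variable *)

Section Flat.
Context {R : realType}.

(* The factor [t^-1 ^+ j] makes the family closed under differentiation, so that
   all orders of smoothness follow from [is_derive_flat]. *)
Definition flat (j : nat) (t : R) : R :=
  if 0 < t then t^-1 ^+ j * expR (- t^-1) else 0.

Lemma flat_gt0 j t : (0 < flat j t) = (0 < t).
Proof.
rewrite /flat; case: ifPn => [t0|]; last by rewrite ltxx.
by rewrite mulr_gt0 ?expR_gt0 ?exprn_gt0 ?invr_gt0.
Qed.

Lemma flat_ge0 j t : 0 <= flat j t.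
Proof.
have [t0|t0] := ltP 0 t; first by rewrite ltW ?flat_gt0.
by rewrite /flat ltNge t0.
Qed.

Lemma flat_eq0 j t : t <= 0 -> flat j t = 0.
Proof. by move=> t0; rewrite /flat ltNge t0. Qed.

(** For [t > 0] the exponential at [t^-1] dominates the degree [j + 2] term of its series; the two
    spare powers of [t^-1] become [t ^+ 2]. *)
Lemma flat_le_sqr j t : `|flat j t| <= j.+2`!%:R * t ^+ 2.
Proof.
rewrite ger0_norm ?flat_ge0 // /flat; case: ifPn => [t0|_]; last first.
  by rewrite mulr_ge0 ?sqr_ge0.
have s0 : 0 <= t^-1 by rewrite invr_ge0 ltW.
have H : t^-1 ^+ j.+2 <= j.+2`!%:R * expR t^-1.
  rewrite mulrC -ler_pdivrMr ?ltr0n ?fact_gt0 //.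
  by apply: le_trans (expR_ge1Dxn j.+1 s0); rewrite lerDr.
rewrite expRN ler_pdivrMr ?expR_gt0 //.
have -> : t^-1 ^+ j = t^-1 ^+ j.+2 * t ^+ 2.
  by rewrite -addn2 exprD exprVn -mulrA exprVn mulVf ?mulr1 // expf_neq0 // gt_eqF.
by rewrite [leRHS]mulrAC ler_wpM2r ?sqr_ge0.
Qed.

Lemma is_derive_sqr_bound (f : R -> R) (C : R) :
  (forall t, `|f t| <= C * t ^+ 2) -> is_derive (0 : R) 1 f 0.
Proof.
move=> fC.
have f0 : f 0 = 0.
  by apply/eqP; rewrite -normr_le0; have := fC 0; rewrite expr0n /= mulr0.
have C0 : 0 <= C by have := le_trans (normr_ge0 _) (fC 1); rewrite expr1n mulr1.
suff cv : (fun h : R => h^-1 *: ((f \o shift 0) (h *: 1) - f 0)) @ 0^' --> (0 : R).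
  by apply: DeriveDef; [apply/cvg_ex; exists 0 | exact: cvg_lim cv].
apply/cvgr0Pnorm_le => e e0.
near=> h => /=.
have h0 : h != 0 by near: h; exact: nbhs_dnbhs_neq.
(* Dividing by [C + 1] covers the case [C = 0]. *)
have hle : `|h| <= e / (C + 1).
  near: h; apply: dnbhs0_le.
  by rewrite divr_gt0 // ltr_pwDr.
rewrite addr0 f0 subr0 [_ *: 1]mulr1 [_ *: _]/(_ * _) normrM normfV.
rewrite ler_pdivrMl ?normr_gt0 //.
apply: le_trans (fC h) _.
rewrite -(@real_normK _ h) ?num_real // expr2 mulrA mulrC ler_wpM2l //.
rewrite mulrC; rewrite ler_pdivlMr ?ltr_pwDr // in hle.
by apply: le_trans hle; rewrite ler_wpM2l // lerDl.
Unshelve. all: by end_near.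
Qed.

(** For [t > 0] the exponential contributes the factor [t ^- 2] and the power contributes [- j]
    times one more [t^-1]; at 0 the quadratic bound forces derivative 0. *)
Lemma is_derive_flat j (t : R) :
  is_derive t 1 (flat j) (flat j.+2 t - j%:R * flat j.+1 t).
Proof.
case: (ltgtP 0 t) => [t0|t0|<-].
- have t0' : t != 0 by rewrite gt_eqF.
  have near_t : \near t, t^-1 ^+ j * expR (- t^-1) = flat j t.
    near=> u; rewrite /flat ifT //; near: u; exact: lt_nbhsr.
  apply: (near_eq_is_derive near_t).
  have dV : is_derive t 1 (fun u : R => u^-1) (- t ^- 2).
    by apply: is_derive_eq; [exact: is_deriveV | rewrite [LHS]mulr1].
  have dE : is_derive t 1 (expR \o (fun u : R => - u^-1)) (expR (- t^-1) * t ^- 2).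
    apply: is_derive1_comp; apply: is_derive_eq; exact: opprK.
  have dX := is_deriveX j dV.
  have := is_deriveM dX dE; rewrite !fctE => dM.
  apply: (is_derive_eq dM); rewrite /flat t0 /=.
  have sE (a b : R) : a *: b = a * b by [].
  by rewrite !sE -exprVn; case: j {near_t dX dM} => [|j] /=; rewrite !exprS; ring.
- have near_t : \near t, cst 0 t = flat j t.
    near=> u; rewrite flat_eq0 // ltW //; near: u; exact: lt_nbhsl.
  rewrite !flat_eq0 1?ltW // mulr0 subr0.
  apply: (near_eq_is_derive near_t).
- rewrite !flat_eq0 // mulr0 subr0; exact: is_derive_sqr_bound (flat_le_sqr j).
Unshelve. all: by end_near.
Qed.

End Flat.

(** * Composition with flat functions, and inverses, in class C^k *)

Section CkComp.
Context {R : realType} {n : nat}.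
Implicit Types (U : set 'rV[R]_n) (f : 'rV[R]_n -> R).

Lemma derive_comp_real (h : R -> R) f x v dh :
  differentiable f x -> is_derive (f x) 1 h dh ->
  'D_v (h \o f) x = dh * 'D_v f x.
Proof.
move=> df [/derivable1_diffP dh1 <-].
rewrite (deriveE v (differentiable_comp df dh1)) (diff_comp df dh1) (deriveE v df) /=.
rewrite (diff1E dh1) derive1E mulrC; reflexivity.
Qed.

(** Induction on [k] for all [j] at once, since the chain rule brings in [flat j.+1] and
    [flat j.+2]. *)
Lemma Ck_on_flat k j U f : open U -> Ck_on k U f -> Ck_on k U (flat j \o f).
Proof.
move=> oU; have dflat i (t : R) : differentiable (flat i) t.
  by apply/derivable1_diffP; case: (is_derive_flat i t).
elim: k j f => [|k IH] j f.
  move=> cf x Ux; apply: continuous_comp; first exact: cf.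
  exact/differentiable_continuous/dflat.
move=> Cf; have [df Df] := Cf.
split=> [x Ux|v]; first by apply: differentiable_comp => //; exact: df.
have H := Ck_onM oU (Ck_onD oU (IH j.+2 _ (Ck_onS Cf))
  (Ck_onM oU (Ck_on_cst k U (- j%:R)) (IH j.+1 _ (Ck_onS Cf)))) (Df v).
apply: Ck_on_ext oU _ H => x Ux.
have dfx := df x Ux.
by rewrite (derive_comp_real v dfx (is_derive_flat j (f x))) mulNr.
Qed.

(** The derivative is a polynomial in [(f x)^-1] times a derivative of [f], hence C^k by
    induction. *)
Lemma Ck_on_inv k U f : open U -> (forall x, U x -> f x != 0) ->
  Ck_on k U f -> Ck_on k U (fun x => (f x)^-1).
Proof.
move=> oU f0; elim: k => [|k IH].
  by move=> cf x Ux; apply: continuousV; [exact: f0|exact: cf].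
move=> Cf; have [df Df] := Cf; have Ci := IH (Ck_onS Cf).
split=> [x Ux|v]; first by apply: differentiableV; [exact: df|exact: f0].
have H := Ck_onM oU (Ck_onM oU (Ck_on_cst k U (-1)) (Ck_onM oU Ci Ci)) (Df v).
apply: Ck_on_ext oU _ H => x Ux.
rewrite deriveV ?f0 //; last by apply: diff_derivable; exact: df.
by rewrite mulN1r -expr2 exprVn.
Qed.

End CkComp.

(** * Extension by zero and bump functions *)

Section SmoothExtra.
Context {R : realType} {n : nat} {M : smoothManifold R n}.
Implicit Types (U V W : set M) (f h : M -> R) (rho : Cinf M).

(** Named so that evaluation can carry a ring morphism structure and pass through sums, products and
    determinants over [Cinf M]. *)
Definition cinf_ev (x : M) (f : Cinf M) : R := f x.

Fact cinf_ev_zmod x : zmod_morphism (cinf_ev x). Proof. by []. Qed.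
Fact cinf_ev_monoid x : monoid_morphism (cinf_ev x). Proof. by []. Qed.
HB.instance Definition _ x :=
  GRing.isZmodMorphism.Build (Cinf M) R (cinf_ev x) (cinf_ev_zmod x).
HB.instance Definition _ x :=
  GRing.isMonoidMorphism.Build (Cinf M) R (cinf_ev x) (cinf_ev_monoid x).

Lemma cinf_ext (f h : Cinf M) : (forall x, f x = h x) -> f = h.
Proof. by move=> fh; apply: val_inj; apply/funext. Qed.

Lemma smooth_on_flat j U f : open U -> smooth_on U f -> smooth_on U (flat j \o f).
Proof.
move=> oU sf c ac k.
exact: (Ck_on_flat (f := f \o chart_inv c) j (chart_image_open oU) (sf c ac k)). 
Qed.

Lemma smooth_on_inv U f : open U -> (forall x, U x -> f x != 0) ->
  smooth_on U f -> smooth_on U (fun x => (f x)^-1).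
Proof.
move=> oU f0 sf c ac k; 
apply: (Ck_on_inv (f := f \o chart_inv c)) (chart_image_open oU) _ (sf c ac k).
by move=> _ [x [cx Ux] <-]; rewrite /= chart_mapK ?inE //; exact: f0.
Qed.

Lemma smooth_chart (c : chart R n M) j : atlas c ->
  smooth_on (chart_dom c) (fun x => c x ord0 j).
Proof. by move=> ac c' ac'; exact: atlas_compat. Qed.

Definition supported_in rho U :=
  exists2 A : set M, closed A /\ A `<=` U & forall x, ~ A x -> rho x = 0.

(** Near a point of the closed set [A] both factors are smooth, and on the open complement of [A]
    the product is 0. *)
Lemma smooth_on_supported rho U W f : open U -> open W -> supported_in rho U ->
  smooth_on (W `&` U) f -> smooth_on W (fun x => rho x * f x).
Proof.
move=> oU oW [A [cA AU] rhoA] sf; apply: smooth_on_local => x Wx.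
have [Ax|nAx] := pselect (A x).
  exists (W `&` U); first by split=> //; exact: AU.
  apply: smooth_onM => //; first exact: openI.
  exact: smooth_on_sub (@subsetT _ _) (cinf_smooth rho).
exists (~` A) => //; apply: smooth_on_ext (smooth_on_cst _ 0).
  exact: closed_openC.
by move=> y nAy; rewrite rhoA // mul0r.
Qed.

(** A flat function of the squared distance in a chart, extended by zero. It vanishes off the image
    [A] of a compact cube, which is closed in [M] because [M] is Hausdorff. *)
Lemma bump_function U x : open U -> U x ->
  exists2 rho : Cinf M, supported_in rho U & (forall y, 0 <= rho y) /\ 0 < rho x.
Proof.
move=> oU Ux; have [c ac cx] := atlas_cover x.
have : nbhs (c x) (c @` (chart_dom c `&` U)).
  by apply: open_nbhs_nbhs; split; [exact: chart_image_open|exists x].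
move=> /nbhs_ballP[_ /posnumP[e] eU].
(* The sup-norm ball of radius [e] contains this closed cube, a product of compact segments. *)
pose K := [set v : 'rV[R]_n | forall j,
  `[c x ord0 j - e%:num / 2, c x ord0 j + e%:num / 2]%classic (v ord0 j)].
have KU : K `<=` c @` (chart_dom c `&` U).
  move=> v Kv; apply: eU; split=> // i j; rewrite (ord1 i) /ball /=.
  have := Kv j; rewrite /= in_itv /= => /andP[h1 h2].
  have e0 : 0 < e%:num :> R by [].
  by rewrite ltr_norml; apply/andP; split; lra.
have compK : compact K by exact: (rV_compact (fun j => @segment_compact R _ _)).
pose A := chart_inv c @` K.
have cA : closed A.
  apply: compact_closed; first exact: mf_hausdorff.
  apply: continuous_compact compK.
  apply: continuous_in_subspaceT => v /set_mem/KU[y [cy _] <-].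
  by apply: chart_inv_continuous; rewrite inE; exists y.
have AU : A `<=` chart_dom c `&` U.
  by move=> _ [v /KU[y [cy Uy] <-] <-]; rewrite chart_mapK ?inE.
(* Within the chart [q y > 0] is a Euclidean ball inscribed in the cube. *)
pose q (y : M) := (e%:num / 2) ^+ 2 - \sum_(j < n) (c y ord0 j - c x ord0 j) ^+ 2.
pose b (y : M) := if pselect (chart_dom c y) then flat 0 (q y) else 0.
have bA y : ~ A y -> b y = 0.
  rewrite /b; case: pselect => // cy nAy.
  have [|q0] := leP (q y) 0; first exact: flat_eq0.
  exfalso; apply: nAy; exists (c y); last by rewrite chart_mapK ?inE.
  move=> j; have: (c y ord0 j - c x ord0 j) ^+ 2 < (e%:num / 2) ^+ 2.
    apply: le_lt_trans (_ : \sum_(j < n) (c y ord0 j - c x ord0 j) ^+ 2 < _).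
      by rewrite (bigD1 j) //= lerDl sumr_ge0 // => i _; exact: sqr_ge0.
    by rewrite -subr_gt0.
  rewrite -[ltLHS]real_normK ?num_real // ltr_pXn2r ?nnegrE ?divr_ge0 //.
  by rewrite /= in_itv /= ltr_norml => /andP[h1 h2]; apply/andP; split; lra.
have sb : smooth_on setT b.
  apply: smooth_on_local => y _; have [cy|ncy] := pselect (chart_dom c y).
    exists (chart_dom c) => //; have oc := chart_dom_open c.
    have sq : smooth_on (chart_dom c) q.
      have sm j := smooth_onD oc (smooth_chart j ac) (smooth_on_cst _ (- c x ord0 j)).
      have sN := smooth_onM oc (smooth_on_cst _ (-1)) (smooth_on_sum
        (index_enum _) oc (fun j => smooth_onM oc (sm j) (sm j))).
      apply: smooth_on_ext oc _ (smooth_onD oc (smooth_on_cst _ ((e%:num / 2) ^+ 2)) sN).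
      by move=> z _; rewrite mulN1r.
    apply: smooth_on_ext oc _ (smooth_on_flat 0 oc sq) => z cz.
    by rewrite /b; case: pselect.
  exists (~` A); first by move=> /AU[].
  apply: smooth_on_ext (closed_openC cA) _ (smooth_on_cst _ 0) => z nAz.
  by rewrite bA.
exists (mkCinf sb); first by exists A => //; split=> // y /AU[].
split=> [y /=|/=]; rewrite /b; case: pselect => // ? ; rewrite ?flat_ge0 //.
rewrite flat_gt0 /q big1 ?subr0 ?exprn_gt0 //.
by move=> j _; rewrite subrr expr0n.
Qed.

End SmoothExtra.

(** * Locally finite sums and partitions of unity *)

Lemma eq_sum_ord_tail0 (V : nmodType) (F : nat -> V) k l :
  (forall i, (k <= i)%N -> F i = 0) -> (forall i, (l <= i)%N -> F i = 0) ->
  \sum_(i < k) F i = \sum_(i < l) F i.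
Proof.
have aux a b : (a <= b)%N -> (forall i, (a <= i)%N -> F i = 0) ->
    \sum_(i < a) F i = \sum_(i < b) F i.
  move=> ab aF; rewrite -(subnKC ab) big_split_ord /= [X in _ + X]big1 ?addr0 //.
  by move=> i _; exact: aF (leq_addr _ _).
by have [kl|/ltnW lk] := leqP k l => kF lF; [exact: aux|apply/esym/aux].
Qed.

Section PartitionOfUnity.
Context {R : realType} {n : nat} {M : smoothManifold R n}.
Implicit Types (f rho : Cinf M).

Lemma cinf_continuous f : continuous f.
Proof.
move=> x; have [c ac cx] := atlas_cover x.
have cxT : (c @` (chart_dom c `&` setT)) (c x) by exists x.
have ci : {for c x, continuous (f \o chart_inv c)}.
  exact: (cinf_smooth f ac 0).
have cc : {for x, continuous c} by apply: chart_map_continuous; rewrite inE.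
have := @continuous_comp _ _ _ c (f \o chart_inv c) x cc ci.
rewrite /prop_for /continuous_at /= chart_mapK ?inE //.
apply: cvg_trans; apply: near_eq_cvg.
have : nbhs x (chart_dom c) by apply: open_nbhs_nbhs; split=> //; exact: chart_dom_open.
by apply: filterS => y cy /=; rewrite chart_mapK ?inE.
Qed.

Section Cover.
Variable P : Cinf M -> Prop.
Hypothesis P0 : P 0.
Hypothesis PM : forall f rho, P rho -> P (f * rho).
Hypothesis Pcover : forall x, exists rho,
  [/\ P rho, forall y, 0 <= rho y & 0 < rho x].

(** The basic open sets on which a single nonnegative member of [P] is positive cover [M]; one such
    member is chosen per basic set, indexed through the injection [e]. *)
Let countable_cover : exists rho : nat -> Cinf M,
  (forall i, P (rho i) /\ forall y, 0 <= rho i y) /\ forall x, exists i, 0 < rho i x.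
Proof.
have [B /countable_injP[e einj] [_ Bbasis]] := @mf_second_countable _ _ M.
pose good rho (b : set M) :=
  [/\ P rho, forall y, 0 <= rho y & forall y, b y -> 0 < rho y].
have /choice[rho rhoP] i : exists rho, (P rho /\ forall y, 0 <= rho y) /\
    forall b, B b -> e b = i -> (exists rho', good rho' b) -> good rho b.
  have [[b [Bb eb [rho [Prho rho0 rhob]]]]|nb] :=
      pselect (exists b, [/\ B b, e b = i & exists rho, good rho b]).
    exists rho; split=> // b' Bb' eb' _.
    by rewrite (einj b' b) ?inE // eb eb'.
  (* The default value 0 serves the indices without such a basic set. *)
  exists 0; split; first by split.
  by move=> b Bb eb ex; exfalso; apply: nb; exists b.
exists rho; split=> [i|x]; first by have [] := rhoP i.
have [f [Pf f0 fx]] := Pcover x.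
have : nbhs x (f @^-1` [set t | 0 < t]).
  exact: cinf_continuous (lt_nbhsr fx).
move=> /Bbasis[b [Bb bx] bf]; exists (e b).
have [_ /(_ b Bb erefl)] := rhoP (e b).
case; first by exists f; split=> // y /bf.
by move=> _ _; exact.
Qed.

(** The closure of [P] under multiplication replaces subordination to a cover: cutting off and
    normalizing the [rho i] both multiply them by smooth functions. The last clause allows any bound
    beyond which the family vanishes at [x]. *)
Lemma partition_of_unity : exists w : nat -> Cinf M,
  [/\ forall i, P (w i),
      forall x : M, exists N, \forall y \near x, forall i, (N <= i)%N -> w i y = 0 &
      forall x N, (forall i, (N <= i)%N -> w i x = 0) -> \sum_(i < N) w i x = 1].
Proof.
have [rho [rhoP rhopos]] := countable_cover.
have cut_smooth i j : smooth_on setT (fun x => flat 0 (i.+1%:R^-1 - rho j x)).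
  apply: (smooth_on_flat (f := fun x => i.+1%:R^-1 - rho j x) 0 openT).
  apply: smooth_on_ext openT _ (smooth_onD openT (smooth_on_cst _ i.+1%:R^-1)
    (smooth_onM openT (smooth_on_cst _ (-1)) (cinf_smooth (rho j)))).
  by move=> x _; rewrite mulN1r.
(* where [rho m > a], all [F i] with [i > m] and [1/(i+1) <= a] vanish *)
pose F i := (\prod_(j < i) mkCinf (cut_smooth i j)) * rho i.
have FE i x : F i x = (\prod_(j < i) flat 0 (i.+1%:R^-1 - rho j x)) * rho i x.
  by rewrite -[LHS]/(cinf_ev x _) rmorphM rmorph_prod.
have F0 i x : 0 <= F i x.
  rewrite FE mulr_ge0 ?prodr_ge0 //; first by move=> j _; exact: flat_ge0.
  by have [] := rhoP i.
have Fpos x : exists i, 0 < F i x.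
  (* At the least [i] with [rho i x > 0] all earlier [rho j x] are 0, so every cutoff factor is
     [flat 0] at a positive number. *)
  have ex := rhopos x; exists (ex_minn ex); case: ex_minnP => i rhoi imin.
  rewrite FE mulr_gt0 // prodr_gt0 // => j _.
  suff /eqP -> : rho j x == 0 by rewrite subr0 flat_gt0 invr_gt0.
  rewrite eq_le (rhoP j).2 andbT leNgt; apply/negP => /imin.
  by rewrite leqNgt ltn_ord.
have Ffin (x : M) : exists N, \forall y \near x, forall i, (N <= i)%N -> F i y = 0.
  have [m rhom] := rhopos x.
  have a0 : 0 < rho m x / 2 by rewrite divr_gt0.
  have [N _ NP] := near_infty_natSinv_lt (PosNum a0).
  exists (maxn N m.+1).
  have : \forall y \near x, rho m x / 2 < rho m y.
    have h : rho m x / 2 < rho m x by lra.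
    exact: cinf_continuous (lt_nbhsr h).
  apply: filterS => y ry i; rewrite geq_max => /andP[Ni mi].
  rewrite FE (bigD1 (Ordinal mi)) //= flat_eq0 ?mul0r //.
  by rewrite subr_le0 ltW // (lt_trans _ ry) //; exact: NP.
have /choice[N NP] := Ffin.
have NFx x i : (N x <= i)%N -> F i x = 0.
  by move=> xi; exact: (nbhs_singleton (NP x)).
pose s x := \sum_(i < N x) F i x.
have sE x k : (forall i, (k <= i)%N -> F i x = 0) -> \sum_(i < k) F i x = s x.
  by move=> kF; exact: (eq_sum_ord_tail0 (F := fun i => F i x) kF (NFx x)).
have s0 x : s x != 0.
  rewrite gt_eqF //; have [i Fi] := Fpos x.
  have iN : (i < N x)%N by rewrite ltnNge; apply/negP => /NFx Fi0; rewrite Fi0 ltxx in Fi.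
  by rewrite /s (bigD1 (Ordinal iN)) /= ?ltr_pwDl ?sumr_ge0 // => j _; exact: (F0 j x).
have ss : smooth_on setT s.
  apply: smooth_on_local => x _.
  (* The bound [N y] varies with [y]; on [V] the fixed bound [N x] serves every point. *)
  pose V := interior [set y | forall i, (N x <= i)%N -> F i y = 0].
  have oV : open V by exact: open_interior.
  exists V; first exact: NP.
  apply: smooth_on_ext oV _ (smooth_on_sum (index_enum 'I_(N x)) oV (fun i =>
    smooth_on_sub (@subsetT _ V) (cinf_smooth (F i)))) => y Vy.
  by apply: sE; exact: interior_subset Vy.
have si := smooth_on_inv openT (fun x _ => s0 x) ss.
exists (fun i => mkCinf si * F i); split=> [i|x|x k kF].
- by apply: PM; apply: PM; have [] := rhoP i.
- exists (N x); apply: filterS (NP x) => y NF i /NF Fi.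
  by rewrite -[LHS]/(_ * F i y) Fi mulr0.
- have {}kF i : (k <= i)%N -> F i x = 0.
    by move=> /kF /eqP; rewrite mulf_eq0 invr_eq0 (negPf (s0 x)) /= => /eqP.
  transitivity (\sum_(i < k) (s x)^-1 * F i x); first exact: eq_bigr.
  by rewrite -mulr_sumr sE // mulVf.
Qed.

End Cover.
End PartitionOfUnity.

(** * Global sections with a prescribed value at a point *)

Section Extension.
Context {R : realType} {n : nat} {M : smoothManifold R n} {r : nat}.
Variable E : vectorBundle M r.
Implicit Types X Y : Sec E.

Lemma sec_sumE (I : Type) (s : seq I) (P : pred I) (F : I -> Sec E) x :
  (\sum_(i <- s | P i) F i) x = \sum_(i <- s | P i) F i x.
Proof. by elim/big_rec2: _ => // i _ y _ <-. Qed.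

Lemma sec_subE X Y x : (X - Y) x = X x - Y x.
Proof. by rewrite -[LHS]/(X x + (-1) *: Y x) scaleN1r. Qed.

Lemma supported_section (U : set M) (s : forall x, E x) (rho : Cinf M) :
  open U -> smooth_section_on U s -> supported_in rho U ->
  exists S : Sec E, forall x, S x = rho x *: s x.
Proof.
move=> oU ss rhoU.
suff sS : smooth_section_on setT (fun x => rho x *: s x) by exists (MkSec sS).
move=> e fe i; rewrite setIT; have oe := frame_dom_open e.
apply: smooth_on_ext oe _ (smooth_on_supported oU oe rhoU (ss e fe i)) => x _.
by rewrite linearZ.
Qed.

(** A local frame of [V] times a bump function extends by zero to global sections of [V]; dividing
    the coordinates of [v] by [rho x] restores the value at [x]. *)
Lemma subbundle_sec (V : forall x, {vspace E x}) (x : M) (v : E x) :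
  is_subbundle V -> v \in V x -> exists2 S : Sec E, sec_in V S & S x = v.
Proof.
move=> [k /(_ x)[U [s [oU Ux ss bs]]]] vV.
have [rho rhoU [_ rhox]] := bump_function oU Ux.
have /choice[S SE] i : exists S : Sec E, forall y, S y = rho y *: s i y.
  exact: supported_section oU (ss i) rhoU.
pose a i := coord [tuple s i x | i < k] i v / rho x.
exists (\sum_i a i *: S i) => [y|].
  rewrite sec_sumE; apply: memv_suml => i _; apply: memvZ; rewrite SE.
  have [Uy|nUy] := pselect (U y).
    apply/memvZ/(basis_mem (bs y Uy)).
    by apply/tnthP; exists i; rewrite tnth_mktuple.
  case: rhoU => A [_ AU] ->; first by rewrite scale0r mem0v.
  by move=> /AU.
rewrite sec_sumE [RHS](coord_basis (bs x Ux) vV); apply: eq_bigr => i _.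
rewrite -[LHS]/(a i *: S i x) SE scalerA divfK ?gt_eqF //.
by rewrite -tnth_nth tnth_mktuple.
Qed.

Lemma is_subbundle_fullv : is_subbundle (fun x => fullv : {vspace E x}).
Proof.
exists r => x; have [e fe ex] := frames_cover E x.
exists (frame_dom e), (fun i y => tnth (e y) i); split=> //.
- exact: frame_dom_open.
- by move=> i e' fe' j; exact: frames_compat.
- move=> y ey; have := frame_basis ey.
  by congr (basis_of _ (tval _)); apply: eq_from_tnth => i; rewrite tnth_mktuple.
Qed.

Lemma sec_at (x : M) (v : E x) : exists S : Sec E, S x = v.
Proof. by have [S _ <-] := subbundle_sec is_subbundle_fullv (memvf v); exists S. Qed.

End Extension.

(** * Sections acting as derivations through the anchor *)

Section Anchored.
Context {R : realType} {n : nat} {M : smoothManifold R n} {r : nat}.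
Variable E : anchoredBundle M r.
Implicit Types (X Y : Sec E) (f h : Cinf M).

Lemma act_addl X Y f : (X + Y) · f = X · f + Y · f.
Proof. by apply: cinf_ext => x /=; rewrite linearD. Qed.

Lemma act_mull X f h : (h *s X) · f = h * (X · f).
Proof. by apply: cinf_ext => x /=; rewrite linearZ. Qed.

Lemma act_addr X f h : X · (f + h) = X · f + X · h.
Proof.
apply: cinf_ext => x /=; have := tg_linear (anchor E x (X x)) 1 f h.
by rewrite scale1r mul1r.
Qed.

Lemma act_mulr X f h : X · (f * h) = f * (X · h) + h * (X · f).
Proof. by apply: cinf_ext => x /=; rewrite tg_leibniz. Qed.

Lemma act_0r X : X · 0 = 0.
Proof. by apply: (addIr (X · 0)); rewrite -act_addr !add0r. Qed.

(** The Leibniz rule for [1 * 1] gives the case of 1, and linearity over the reals the rest. *)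
Lemma act_cst X (a : R) : X · (mkCinf (smooth_on_cst [set: M] a)) = 0.
Proof.
have one : X · 1 = 0.
  by apply: (addIr (X · 1)); rewrite add0r -{3}[1]mulr1 act_mulr !mul1r.
apply: cinf_ext => x; have := tg_linear (anchor E x (X x)) a 1 0.
have e1 : anchor E x (X x) 1 = 0 := congr1 (cinf_ev x) one.
have e0 : anchor E x (X x) 0 = 0 := congr1 (cinf_ev x) (act_0r X).
rewrite e1 e0 mulr0 !addr0; apply: etrans; congr (anchor E x (X x) _).
by apply: cinf_ext => y; rewrite -[RHS]/(a * 1) mulr1.
Qed.

End Anchored.

(** * Algebra of the Koszul formula *)

Section Algebra.
Context {R : realType} {n : nat} {M : smoothManifold R n} {r : nat}.
Context {E : lieAlgebroid M r}.
Variable g : semiRiemannian E.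
Implicit Types (X Y Z W U : Sec E) (f h : Cinf M).

Local Notation "'⟨' X , Y '⟩'" := (pair g X Y) : ring_scope.

Lemma pairC X Y : ⟨X, Y⟩ = ⟨Y, X⟩.
Proof. by apply: cinf_ext => x /=; rewrite hermC /= mul1r. Qed.

Lemma pair_addl X Y Z : ⟨X + Y, Z⟩ = ⟨X, Z⟩ + ⟨Y, Z⟩.
Proof. by apply: cinf_ext => x /=; rewrite linearDl. Qed.

Lemma pair_mull f X Z : ⟨f *s X, Z⟩ = f * ⟨X, Z⟩.
Proof. by apply: cinf_ext => x /=; rewrite linearZl_LR. Qed.

Lemma pair_addr X Y Z : ⟨Z, X + Y⟩ = ⟨Z, X⟩ + ⟨Z, Y⟩.
Proof. by rewrite pairC pair_addl !(pairC _ Z). Qed.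

Lemma pair_mulr f X Z : ⟨Z, f *s X⟩ = f * ⟨Z, X⟩.
Proof. by rewrite pairC pair_mull (pairC Z). Qed.

Lemma lie_addr X Y Z : ⟦X, Y + Z⟧ = ⟦X, Y⟧ + ⟦X, Z⟧.
Proof. by have := lie_linearr X 1 Y Z; rewrite !scale1r. Qed.

Lemma lie_addl X Y Z : ⟦X + Y, Z⟧ = ⟦X, Z⟧ + ⟦Y, Z⟧.
Proof. by have := lie_linearl Z 1 X Y; rewrite !scale1r. Qed.

Lemma lieC X Y : ⟦X, Y⟧ = - ⟦Y, X⟧.
Proof.
have := lie_alt (X + Y); rewrite lie_addl !lie_addr !lie_alt add0r addr0.
by move/eqP; rewrite addr_eq0 => /eqP.
Qed.

Lemma pair_oppl X Z : ⟨- X, Z⟩ = - ⟨X, Z⟩.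
Proof. by apply: cinf_ext => x /=; rewrite scaleN1r linearNl. Qed.

Lemma pair_lieC X Y Z : ⟨⟦X, Y⟧, Z⟩ = - ⟨⟦Y, X⟧, Z⟩.
Proof. by rewrite lieC pair_oppl. Qed.

Lemma cinf_mulr2n_inj f h : f *+ 2 = h *+ 2 -> f = h.
Proof.
move=> e; apply: cinf_ext => x; have /(congr1 (cinf_ev x)) := e.
by rewrite !rmorphMn => /eqP; rewrite eqrMn2r // => /eqP.
Qed.

Lemma pair_mulr2n_ker U : (forall Z, ⟨U, Z⟩ *+ 2 = 0) -> sec_in (metric_ker g) U.
Proof.
move=> U0 x; apply/metric_kerP => v; have [Z <-] := sec_at v.
have /cinf_mulr2n_inj/(congr1 (cinf_ev x)) // : ⟨U, Z⟩ *+ 2 = 0 *+ 2.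
by rewrite U0 mul0rn.
Qed.

Lemma pair_ker U X : sec_in (metric_ker g) U -> ⟨U, X⟩ = 0.
Proof. by move=> UK; apply: cinf_ext => x; have /metric_kerP/(_ (X x)) := UK x. Qed.

(** Metric compatibility applied to [⟨U, W⟩ = 0] gives [⟨D Z U, W⟩ = 0]; expanding the brackets by
    torsion-freeness then leaves terms that cancel. *)
Lemma koszul_lie_derivative D U X Y :
  koszul_derivative g D -> sec_in (metric_ker g) U -> lie_derivative g U X Y = 0.
Proof.
move=> kD UK; have DU0 Z W : ⟨D Z U, W⟩ = 0.
  by have := kd_c kD U W Z; rewrite !(pair_ker _ UK) act_0r addr0.
rewrite /lie_derivative (kd_c kD) (pairC X ⟦U, Y⟧) -!(kd_d kD) !DU0 !subr0.
rewrite (pairC X). ring.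
Qed.

Lemma koszul_derivative_formula D : koszul_derivative g D -> koszul_formula g D.
Proof.
move=> kD X Y Z; rewrite !(kd_c kD) -!(kd_d kD) mulr2n.
rewrite (pairC Y) (pairC Z (D Y X)) (pairC X (D Z Y)).
ring.
Qed.

Definition koszul_rhs X Y Z : Cinf M :=
  X · ⟨Y, Z⟩ + Y · ⟨Z, X⟩ - Z · ⟨X, Y⟩ + ⟨⟦X, Y⟧, Z⟩ - ⟨⟦Y, Z⟧, X⟩ - ⟨⟦X, Z⟧, Y⟩.

Local Notation κ := koszul_rhs.

Lemma pair_lie_mulr f X Y Z :
  ⟨⟦X, f *s Y⟧, Z⟩ = f * ⟨⟦X, Y⟧, Z⟩ + (X · f) * ⟨Y, Z⟩.
Proof. by rewrite lie_leibniz pair_addl !pair_mull. Qed.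

Lemma pair_lie_mull f X Y Z :
  ⟨⟦f *s X, Y⟧, Z⟩ = f * ⟨⟦X, Y⟧, Z⟩ - (Y · f) * ⟨X, Z⟩.
Proof. rewrite pair_lieC pair_lie_mulr (pair_lieC Y); ring. Qed.

Lemma koszul_rhs_addr X Y Z W : κ X Y (Z + W) = κ X Y Z + κ X Y W.
Proof.
rewrite /κ !lie_addr !pair_addr !pair_addl !act_addr !act_addl; ring.
Qed.

Lemma koszul_rhs_addm X Y Z W : κ X (Y + W) Z = κ X Y Z + κ X W Z.
Proof.
rewrite /κ lie_addr lie_addl !pair_addl !pair_addr !act_addr !act_addl; ring.
Qed.

Lemma koszul_rhs_addl X Y Z W : κ (X + W) Y Z = κ X Y Z + κ W Y Z.
Proof.
rewrite /κ !lie_addl !pair_addl !pair_addr !act_addr !act_addl; ring.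
Qed.

(** The derivatives of [f] along [X] and [Y] cancel against those from the brackets with
    [f *s Z]. *)
Lemma koszul_rhs_mulr f X Y Z : κ X Y (f *s Z) = f * κ X Y Z.
Proof.
rewrite /κ !pair_lie_mulr !pair_mulr !pair_mull !act_mulr act_mull.
rewrite (pairC Z X) (pairC Z Y); ring.
Qed.

Lemma koszul_rhs_mull f X Y Z : κ (f *s X) Y Z = f * κ X Y Z.
Proof.
rewrite /κ !pair_lie_mull !pair_mulr !pair_mull !act_mulr act_mull.
rewrite (pairC Z X); ring.
Qed.

Lemma koszul_rhs_mulm f X Y Z :
  κ X (f *s Y) Z = ((X · f) * ⟨Y, Z⟩) *+ 2 + f * κ X Y Z.
Proof.
rewrite /κ pair_lie_mull pair_lie_mulr !pair_mulr !pair_mull !act_mulr act_mull.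
rewrite (pairC Y X); ring.
Qed.

Lemma koszul_rhs_metric X Y Z : κ Z X Y + κ Z Y X = (Z · ⟨X, Y⟩) *+ 2.
Proof.
rewrite /κ (pairC Y X) (pairC X Z) (pairC Z Y) (pair_lieC X Y); ring.
Qed.

Lemma koszul_rhs_torsion X Y W : κ X Y W - κ Y X W = ⟨⟦X, Y⟧, W⟩ *+ 2.
Proof.
rewrite /κ !(pairC W) (pairC Y X) (pair_lieC Y X); ring.
Qed.

(** This turns the hypothesis on Lie derivatives into the solvability condition: a functional
    represented by [g] must vanish on the kernel. *)
Lemma koszul_rhs_ker X Y U : sec_in (metric_ker g) U ->
  κ X Y U = - lie_derivative g U X Y.
Proof.
move=> UK; rewrite /κ /lie_derivative (pairC Y U) !(pair_ker _ UK) !act_0r.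
rewrite (pairC ⟦X, Y⟧) (pair_ker _ UK) (pair_lieC Y U) (pair_lieC X U).
rewrite (pairC X ⟦U, Y⟧).
ring.
Qed.

(** After cancelling 2 each axiom is an identity for [koszul_rhs]. Linearity is assumed separately
    because the formula controls [D] only modulo the kernel. *)
Lemma koszul_formula_derivative D : (forall Y, linear (D^~ Y)) ->
  (forall X, linear (D X)) -> koszul_formula g D -> koszul_derivative g D.
Proof.
move=> Dl Dr kD; have {}kD X Y Z : ⟨D X Y, Z⟩ *+ 2 = κ X Y Z by exact: kD.
split=> // [f X Z W|f X Y W|X Y Z|X Y W]; apply: cinf_mulr2n_inj.
- by rewrite kD koszul_rhs_mull -kD mulrnAr.
- by rewrite kD koszul_rhs_mulm -kD mulrnDl mulrnAr.
- by rewrite (pairC X (D Z Y)) mulrnDl !kD koszul_rhs_metric.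
- by rewrite mulrnBl !kD koszul_rhs_torsion.
Qed.

End Algebra.

(** * Pointwise dependence of tensors *)

Section Tensoriality.
Context {R : realType} {n : nat} {M : smoothManifold R n} {r : nat}.
Variable E : vectorBundle M r.

(* [rho ^+ 2 *s Z] is globally a combination of sections [rho e_i] with
   coefficients [rho Z_i], and the latter vanish at [x] *)
Lemma tensor_eq0_at (l : Sec E -> Cinf M) (Z : Sec E) x :
  (forall X Y, l (X + Y) = l X + l Y) -> (forall f X, l (f *s X) = f * l X) ->
  Z x = 0 -> l Z x = 0.
Proof.
move=> lD lM Zx; have [e fe ex] := frames_cover E x.
have oe := frame_dom_open e.
have [rho rhoe [_ rhox]] := bump_function oe ex.
have /choice[S SE] i : exists S : Sec E, forall y, S y = rho y *: tnth (e y) i.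
  by apply: supported_section oe _ rhoe => e' fe' j; exact: frames_compat.
have sc i : smooth_on setT (fun y => rho y * coord (e y) i (Z y)).
  by apply: (smooth_on_supported oe openT rhoe); rewrite setTI; exact: sec_coord_smooth.
have l0 : l 0 = 0 by apply: (addIr (l 0)); rewrite -lD !add0r.
have lsum (F : 'I_r -> Sec E) : l (\sum_i F i) = \sum_i l (F i).
  by rewrite (big_morph l lD l0).
have /(congr1 l)/(congr1 (cinf_ev x)) : rho *s (rho *s Z) = \sum_i mkCinf (sc i) *s S i.
  apply: secP => y; rewrite sec_sumE /=.
  have [ey|ney] := pselect (frame_dom e y).
    rewrite [in LHS](sec_coordE Z ey) !scaler_sumr; apply: eq_bigr => i _.
    by rewrite SE !scalerA; congr (_ *: _); ring.
  have [A [_ Ae] rhoA] := rhoe.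
  by rewrite rhoA ?big1 ?scale0r // => [i _|/Ae //]; rewrite mul0r scale0r.
rewrite !lM lsum rmorph_sum big1 => [|i _].
  rewrite !rmorphM => /eqP; rewrite !mulf_eq0 (gt_eqF (rhox : 0 < cinf_ev x rho)) /=.
  by move/eqP.
by rewrite lM rmorphM /= /cinf_ev /= Zx linear0 mulr0 mul0r.
Qed.

End Tensoriality.

(** * Gram matrices of a degenerate symmetric form *)

Section Gram.
Context {F : fieldType} {V : vectType F} (B : {symmetric V}) {m : nat}.
Variable s : m.-tuple V.

Definition gram : 'M[F]_m := \matrix_(i, j) B (tnth s i) (tnth s j).
Let K := orthov B fullv.

Lemma row_mul_gram (a : 'rV[F]_m) :
  a *m gram = \row_j B (\sum_i a 0 i *: tnth s i) (tnth s j).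
Proof.
apply/rowP => j; rewrite !mxE linear_sumlz; apply: eq_bigr => i _.
by rewrite mxE linearZl_LR.
Qed.

Lemma gram_ker_eq0 (a : 'rV[F]_m) : \det gram != 0 ->
  \sum_i a 0 i *: tnth s i \in K -> a = 0.
Proof.
move=> dG /mem_orthovP aK; apply/eqP; apply: contraNT dG => a0.
apply/det0P; exists a => //; rewrite row_mul_gram.
by apply/rowP => j; rewrite !mxE aK // memvf.
Qed.

(** A nonzero determinant makes [s] free with span meeting [K] trivially, so the dimension count
    makes the span a complement of [K]. *)
Lemma gram_decomp (w : V) : \det gram != 0 -> (m + \dim K)%N = \dim {:V} ->
  exists a : 'I_m -> F, w - \sum_i a i *: tnth s i \in K.
Proof.
move=> dG dimK.
have sE (a : 'I_m -> F) : \sum_i a i *: s`_i = \sum_i (\row_j a j) 0 i *: tnth s i.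
  by apply: eq_bigr => i _; rewrite mxE -tnth_nth.
have fs : free s.
  apply/freeP => a; rewrite sE => a0 i.
  have /rowP/(_ i) : \row_j a j = 0 by apply: gram_ker_eq0; rewrite // a0 mem0v.
  by rewrite !mxE.
have cap0 : (<< s >> :&: K)%VS = 0%VS.
  apply/eqP; rewrite -subv0; apply/subvP => u; rewrite memv_cap memv0.
  case/andP=> /coord_span -> ; rewrite sE => /(gram_ker_eq0 dG) ->.
  by rewrite big1 // => i _; rewrite mxE scale0r.
have /eqP full : (<< s >> + K)%VS == fullv.
  rewrite eqEdim subvf /= (dimv_disjoint_sum cap0) -dimK.
  by move: fs; rewrite /free size_tuple => /eqP ->.
have : w \in (<< s >> + K)%VS by rewrite full memvf.
case/memv_addP => u us [v vK ->]; exists (coord s ^~ u).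
rewrite [X in X + v - _](coord_span us).
have -> : \sum_i coord s i u *: s`_i = \sum_i coord s i u *: tnth s i.
  by apply: eq_bigr => i _; rewrite -tnth_nth.
by rewrite addrAC subrr add0r.
Qed.

(** A null vector of the Gram matrix gives [u] in the span orthogonal to the span and to [K], hence
    to everything; so [u] is in [K] and is 0. *)
Lemma det_gram_neq0 : free s -> (<< s >> + K)%VS = fullv -> (<< s >> :&: K)%VS = 0%VS ->
  \det gram != 0.
Proof.
move=> fs full cap0; apply/det0P => -[a a0 aG]; case/eqP: a0.
pose u := \sum_i a 0 i *: tnth s i.
have us : u \in << s >>%VS by apply: memv_suml => i _; apply/memvZ/memv_span/mem_tnth.
have us0 v : v \in << s >>%VS -> B u v = 0.
  move=> /coord_span ->; rewrite linear_sumr big1 // => i _.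
  have ui : B u (tnth s i) = 0.
    by have /rowP/(_ i) := aG; rewrite row_mul_gram !mxE.
  by rewrite -tnth_nth linearZr_LR /= ui mulr0.
have : u \in (<< s >> :&: K)%VS.
  rewrite memv_cap us /=; apply/mem_orthovP => v _.
  have : v \in (<< s >> + K)%VS by rewrite full memvf.
  case/memv_addP => v1 v1s [v2 /mem_orthovP v2K ->].
  by rewrite linearDr /= us0 // hermC /= v2K ?memvf // mulr0 addr0.
rewrite cap0 memv0 => /eqP u0; apply/rowP => i; rewrite mxE.
move/freeP: fs => /(_ (a 0)); apply; rewrite -[RHS]u0.
by apply: eq_bigr => j _; rewrite -tnth_nth.
Qed.

End Gram.

(** * Local solutions and their gluing *)

Section Existence.
Context {R : realType} {n : nat} {M : smoothManifold R n} {r : nat}.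
Context {E : lieAlgebroid M r}.
Variable g : semiRiemannian E.
Variable C : forall x, {vspace E x}.
Implicit Types (X Y Z W U : Sec E) (f h rho : Cinf M).

Local Notation "'⟨' X , Y '⟩'" := (pair g X Y) : ring_scope.
Local Notation κ := (koszul_rhs g).

Lemma dim_fiber (x : M) : \dim {: E x} = r.
Proof.
have [e _ ex] := frames_cover E x.
exact: size_basis (frame_basis ex).
Qed.

Lemma secZE (a : R) X : a *: X = mkCinf (smooth_on_cst setT a) *s X.
Proof. by []. Qed.

Lemma pair_suml (I : Type) (s : seq I) (F : I -> Sec E) Z :
  ⟨\sum_(i <- s) F i, Z⟩ = \sum_(i <- s) ⟨F i, Z⟩.
Proof.
apply: (big_morph (fun X => ⟨X, Z⟩)) => [X Y|]; first exact: pair_addl.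
by apply: cinf_ext => x; rewrite /= linear0l.
Qed.

(** A [C]-valued solution for the right-hand side weighted by [rho]. The last clause lets local
    finiteness of the weights pass to the solutions. *)
Definition local_koszul rho (D : Sec E -> Sec E -> Sec E) : Prop :=
  [/\ forall Y, linear (D^~ Y), forall X, linear (D X),
      forall X Y, sec_in C (D X Y),
      forall X Y Z, ⟨D X Y, Z⟩ *+ 2 = rho * κ X Y Z &
      forall X Y x, rho x = 0 -> D X Y x = 0].

Lemma koszul_rhs_linearl (a : R) X Y Z W :
  κ (a *: X + W) Y Z = mkCinf (smooth_on_cst setT a) * κ X Y Z + κ W Y Z.
Proof. by rewrite koszul_rhs_addl secZE koszul_rhs_mull. Qed.

Lemma koszul_rhs_linearm (a : R) X Y Z W :
  κ X (a *: Y + W) Z = mkCinf (smooth_on_cst setT a) * κ X Y Z + κ X W Z.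
Proof.
by rewrite koszul_rhs_addm secZE koszul_rhs_mulm act_cst mul0r mul0rn add0r.
Qed.

Lemma local_koszul_mul f rho D : local_koszul rho D ->
  local_koszul (f * rho) (fun X Y => f *s D X Y).
Proof.
case=> Dl Dr DC Drho D0; split=> [Y a X W|X a Y W|X Y x|X Y Z|X Y x].
- by rewrite Dl; apply: secP => x /=; rewrite scalerDr !scalerA mulrC.
- by rewrite Dr; apply: secP => x /=; rewrite scalerDr !scalerA mulrC.
- exact/memvZ/DC.
- by rewrite pair_mull -mulrnAr Drho mulrA.
- move=> /eqP; rewrite mulf_eq0 => /orP[/eqP f0|/eqP /D0 D0x] /=.
    by rewrite f0 scale0r.
  by rewrite D0x scaler0.
Qed.

Hypothesis gK : forall U, sec_in (metric_ker g) U ->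
  forall X Y, lie_derivative g U X Y = 0.

(** [W] lies in the kernel only at [x]: it is compared with a section [U] of the kernel through
    [W x], and tensoriality disposes of [W - U]. *)
Lemma koszul_rhs_ker_at X Y W x : W x \in metric_ker g x -> κ X Y W x = 0.
Proof.
move=> Wx; have [U UK Ux] := subbundle_sec (metric_ker_subbundle g) Wx.
have /(congr1 (cinf_ev x)) : κ X Y W = κ X Y (W - U) + κ X Y U.
  by rewrite -koszul_rhs_addr subrK.
rewrite (koszul_rhs_ker _ _ UK) gK // oppr0 addr0 /cinf_ev => ->.
apply: (@tensor_eq0_at _ _ _ _ _ (κ X Y)); first exact: koszul_rhs_addr.
  by move=> f Z; exact: koszul_rhs_mulr.
by rewrite sec_subE Ux subrr.
Qed.

Section GramSolution.
Variables (m : nat) (S : 'I_m -> Sec E).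
Hypothesis dimS : forall x, (m + \dim (metric_ker g x))%N = r.
Hypothesis SC : forall i, sec_in C (S i).

Let G : 'M[Cinf M]_m := \matrix_(i, j) ⟨S i, S j⟩.
Let d := \det G.
Let c X Y i := \sum_j \adj G i j * κ X Y (S j).
Let D0 X Y := \sum_i c X Y i *s S i.

(** Cramer's rule, [G *m \adj G] being [d] times the identity. *)
Let pair_D0 X Y l : ⟨D0 X Y, S l⟩ = d * κ X Y (S l).
Proof.
have -> : ⟨D0 X Y, S l⟩ = \sum_j (G *m \adj G) l j * κ X Y (S j).
  rewrite pair_suml; under eq_bigr do rewrite pair_mull mulr_suml.
  rewrite exchange_big; apply: eq_bigr => j _; rewrite mxE mulr_suml.
  by apply: eq_bigr => i _; rewrite [G l i]mxE (pairC g (S l)); ring.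
rewrite mul_mx_adj (bigD1 l) //= mxE eqxx mulr1n big1 ?addr0 // => j /negPf jl.
by rewrite mxE eq_sym jl mulr0n mul0r.
Qed.

Lemma det_gram_sections x :
  d x = \det (gram (metric g x) [tuple S i x | i < m]).
Proof.
rewrite -[LHS]/(cinf_ev x _) -det_map_mx; congr (\det _).
by apply/matrixP => i j; rewrite !mxE !tnth_mktuple.
Qed.

(** Where [d] is nonzero, [Z] agrees at [x] modulo the kernel with a constant combination [W] of the
    [S i]; both sides ignore the kernel part, and [W] is settled by linearity. *)
Let pair_D0_at X Y Z x : d x != 0 -> ⟨D0 X Y, Z⟩ x = d x * κ X Y Z x.
Proof.
move=> d0; have dx := d0; rewrite det_gram_sections in dx.
have [|a Za] := gram_decomp (Z x) dx; first by rewrite dim_fiber dimS.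
pose W := \sum_i a i *: S i.
have Wx : W x = \sum_i a i *: tnth [tuple S i x | i < m] i.
  by rewrite sec_sumE; apply: eq_bigr => i _; rewrite tnth_mktuple.
rewrite -Wx in Za.
have ZWx := sec_subE Z W x.
have k0 : κ X Y Z x = κ X Y W x.
  apply/eqP; rewrite -subr_eq0; apply/eqP.
  have <- : κ X Y (Z - W) x = κ X Y Z x - κ X Y W x.
    have := koszul_rhs_addr g X Y (Z - W) W; rewrite subrK => ->.
    by rewrite -[X in _ = X - _]/(_ x + _ x) addrK.
  by apply: koszul_rhs_ker_at; rewrite ZWx.
have p0 V : ⟨V, Z⟩ x = ⟨V, W⟩ x.
  rewrite -{1}(subrK W Z) pair_addr -[RHS]add0r -[LHS]/(_ x + _ x); congr (_ + _).
  rewrite -[LHS]/(metric g x (V x) ((Z - W) x)) ZWx hermC /= mul1r.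
  by have /metric_kerP := Za; exact.
rewrite k0 p0.
pose P V := ⟨D0 X Y, V⟩ = d * κ X Y V.
suff PW : P W by exact: (congr1 (cinf_ev x) PW).
rewrite /W; elim/big_rec: _ => [|i V _ PV].
  apply: cinf_ext => y.
  have -> : (0 : Sec E) = mkCinf (smooth_on_cst setT 0) *s 0.
    by apply: secP => z; rewrite /= scale0r.
  by rewrite pair_mulr koszul_rhs_mulr /= !mul0r mulr0.
rewrite /P pair_addr koszul_rhs_addr PV secZE pair_mulr koszul_rhs_mulr pair_D0.
ring.
Qed.

(** The extra factor [d] makes both sides vanish where [d] does, so the formula holds globally, and
    makes the weight nonnegative. *)
Lemma local_koszul_gram : local_koszul (d * d *+ 2) (fun X Y => d *s D0 X Y).
Proof.
have cl a X Y W i :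
    c (a *: X + W) Y i = mkCinf (smooth_on_cst setT a) * c X Y i + c W Y i.
  rewrite /c mulr_sumr -big_split; apply: eq_bigr => j _ /=.
  by rewrite koszul_rhs_linearl; ring.
have cr a X Y W i :
    c X (a *: Y + W) i = mkCinf (smooth_on_cst setT a) * c X Y i + c X W i.
  rewrite /c mulr_sumr -big_split; apply: eq_bigr => j _ /=.
  by rewrite koszul_rhs_linearm; ring.
split=> [Y a X W|X a Y W|X Y x|X Y Z|X Y x].
- apply: secP => x; rewrite /= -[RHS]/(a *: (_ *: _) + _ *: _) /D0 !sec_sumE.
  rewrite scalerA mulrC -scalerA -scalerDr; congr (_ *: _).
  rewrite scaler_sumr -big_split; apply: eq_bigr => i _.
  by rewrite cl /= scalerDl scalerA.
- apply: secP => x; rewrite /= -[RHS]/(a *: (_ *: _) + _ *: _) /D0 !sec_sumE.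
  rewrite scalerA mulrC -scalerA -scalerDr; congr (_ *: _).
  rewrite scaler_sumr -big_split; apply: eq_bigr => i _.
  by rewrite cr /= scalerDl scalerA.
- by rewrite /= sec_sumE; apply/memvZ/memv_suml => i _; exact/memvZ/SC.
- rewrite pair_mull mulrnAl -mulrA; congr (_ *+ 2); apply: cinf_ext => x.
  rewrite -[LHS]/(d x * ⟨_, _⟩ x) -[RHS]/(d x * (d x * _)).
  by have [->|dx] := eqVneq (d x) 0; rewrite ?mul0r // pair_D0_at.
- rewrite -[X in X = _]/((d x * d x) *+ 2) => /eqP.
  by rewrite mulrn_eq0 /= mulf_eq0 orbb => /eqP /= ->; rewrite scale0r.
Qed.

End GramSolution.

(** Each [D i X Y] vanishes where [w i] does, so the sum is locally finite and smooth. *)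
Lemma local_koszul_sum (w : nat -> Cinf M) :
  (forall i, exists D, local_koszul (w i) D) ->
  (forall x : M, exists N, \forall y \near x, forall i, (N <= i)%N -> w i y = 0) ->
  (forall x N, (forall i, (N <= i)%N -> w i x = 0) -> \sum_(i < N) w i x = 1) ->
  exists D, local_koszul 1 D.
Proof.
move=> /choice[D DP] /choice[N NP] w1.
have NE x i : (N x <= i)%N -> w i x = 0.
  by move=> xi; exact: (nbhs_singleton (NP x)).
have DN X Y x k : (forall i, (k <= i)%N -> w i x = 0) ->
    \sum_(i < k) D i X Y x = \sum_(i < N x) D i X Y x.
  move=> kw; apply: (eq_sum_ord_tail0 (F := fun i => D i X Y x)) => i.
    by move=> /kw; have [_ _ _ _ Di0] := DP i; exact: Di0.
  by move=> /NE; have [_ _ _ _ Di0] := DP i; exact: Di0.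
have Dsmooth X Y : smooth_section_on setT (fun x => \sum_(i < N x) D i X Y x).
  move=> e fe j; apply: smooth_on_local => x [ex _].
  pose V := interior [set y | forall i, (N x <= i)%N -> w i y = 0].
  have oV : open (frame_dom e `&` V).
    by apply: openI; [exact: frame_dom_open|exact: open_interior].
  exists (frame_dom e `&` V); first by split=> //; exact: NP.
  have eV : frame_dom e `&` V `<=` frame_dom e by move=> y [].
  apply: smooth_on_ext oV _ (smooth_on_sub eV
    (sec_coord_smooth (\sum_(i < N x) D i X Y) j fe)) => y [ey Vy].
  by rewrite sec_sumE DN // => i; exact: interior_subset Vy i.
exists (fun X Y => MkSec (Dsmooth X Y)); split=> [Y a X W|X a Y W|X Y x|X Y Z|X Y x].
- apply: secP => x /=; rewrite scaler_sumr -big_split /=; apply: eq_bigr => i _.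
  by have [-> _ _ _ _] := DP i.
- apply: secP => x /=; rewrite scaler_sumr -big_split /=; apply: eq_bigr => i _.
  by have [_ -> _ _ _] := DP i.
- by apply: memv_suml => i _; have [_ _ DC _ _] := DP i; exact: DC.
(* The weight 1 is expanded as the sum of the [w i x], and the formula is then checked term by
   term. *)
- apply: cinf_ext => x; rewrite mul1r -[RHS]mul1r -(w1 x (N x) (NE x)).
  rewrite -[LHS]/(⟨_, _⟩ x *+ 2) /= linear_sumlz -sumrMnl mulr_suml.
  by apply: eq_bigr => i _; have [_ _ _ /(_ X Y Z)/(congr1 (cinf_ev x)) Di _] := DP i.
- by move=> /eqP; rewrite oner_eq0.
Qed.

(** Stated for [C] spanning together with the kernel, so as to cover both [C = E] and a
    complementary [C]. *)
Lemma koszul_exists : is_subbundle C ->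
  (forall x, (C x + metric_ker g x)%VS = fullv) ->
  exists D, (forall X Y, sec_in C (D X Y)) /\ koszul_derivative g D.
Proof.
move=> sC CK.
have [k dimK] : exists k, forall x, \dim (metric_ker g x) = k.
  have [k kP] := metric_ker_subbundle g; exists k => x.
  have [U [s [_ Ux _ /(_ x Ux) bs]]] := kP x.
  exact: size_basis bs.
have P0 : exists D, local_koszul 0 D.
  exists (fun _ _ => 0); split=> [Y a X W|X a Y W|X Y x|X Y Z|//].
  + by rewrite scaler0 addr0.
  + by rewrite scaler0 addr0.
  + exact: mem0v.
  + by apply: cinf_ext => x; rewrite mul0r /= -[LHS]/(_ *+ 2) linear0l mul0rn.
have PM f rho : (exists D, local_koszul rho D) -> exists D, local_koszul (f * rho) D.
  by case=> D DP; exists (fun X Y => f *s D X Y); exact: local_koszul_mul.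
suff Pcover x : exists rho, [/\ exists D, local_koszul rho D,
    forall y, 0 <= rho y & 0 < rho x].
  have [w [wD wfin w1]] := partition_of_unity P0 PM Pcover.
  have [D [Dl Dr DC D1 _]] := local_koszul_sum wD wfin w1.
  exists D; split=> //; apply: koszul_formula_derivative => // X Y Z.
  by rewrite D1 mul1r.
(* [T] is a complement of the kernel at [x] inside [C x]; a basis of it, extended to sections of
   [C], has nonzero Gram determinant at [x]. *)
pose T := (C x :\: metric_ker g x)%VS.
have TK : (T :&: metric_ker g x)%VS = 0%VS by exact: capv_diff.
have TKf : (T + metric_ker g x)%VS = fullv by rewrite addv_diff CK.
have dimT : (\dim T + k)%N = r by rewrite -(dimK x) -dimv_disjoint_sum // TKf dim_fiber.
have /choice[S SP] (i : 'I_(\dim T)) : exists S, sec_in C S /\ S x = (vbasis T)`_i.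
  have [|S SC Sx] := @subbundle_sec _ _ _ _ E C x (vbasis T)`_i sC; last by exists S.
  by apply: (subvP (diffvSl _ _)); apply: vbasis_mem; apply: mem_nth; rewrite size_tuple.
have dimS y : (\dim T + \dim (metric_ker g y))%N = r by rewrite dimK.
have LG := local_koszul_gram dimS (fun i => (SP i).1).
eexists; split; first by eexists; exact: LG.
  by move=> y; rewrite -[leRHS]/((_ y * _ y) *+ 2) mulrn_wge0 // -expr2 sqr_ge0.
rewrite -[ltRHS]/((_ x * _ x) *+ 2) pmulrn_lgt0 // -expr2 exprn_even_gt0 //=.
rewrite det_gram_sections.
have -> : [tuple S i x | i < \dim T] = vbasis T.
  by apply: eq_from_tnth => i; rewrite tnth_mktuple (SP i).2 -tnth_nth.
have sT := span_basis (vbasisP T).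
by apply: det_gram_neq0; rewrite ?sT //; exact: basis_free (vbasisP T).
Qed.

End Existence.

(** * The equivalence, and uniqueness modulo the kernel *)

Theorem theorem4p9 (R : realType) (n : nat) (M : smoothManifold R n) (r : nat)
    (E : lieAlgebroid M r) (g : semiRiemannian E) :
  ((exists D : Sec E -> Sec E -> Sec E, koszul_derivative g D) <->
   (forall U : Sec E, sec_in (metric_ker g) U ->
      forall X Y : Sec E, lie_derivative g U X Y = 0))
  /\
  ((forall U : Sec E, sec_in (metric_ker g) U ->
      forall X Y : Sec E, lie_derivative g U X Y = 0) ->
   [/\ (forall D : Sec E -> Sec E -> Sec E,
          koszul_derivative g D -> koszul_formula g D),
       (forall D D' : Sec E -> Sec E -> Sec E,
          koszul_formula g D -> koszul_formula g D' ->
          forall X Y : Sec E, sec_in (metric_ker g) (D X Y - D' X Y)) &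
       (forall C : (forall x : M, {vspace E x}),
          is_subbundle C -> complementary (metric_ker g) C ->
          exists! D : Sec E -> Sec E -> Sec E,
            koszul_derivative g D /\ forall X Y : Sec E, sec_in C (D X Y))]).
Proof.
have uniq D D' : koszul_formula g D -> koszul_formula g D' ->
    forall X Y, sec_in (metric_ker g) (D X Y - D' X Y).
  move=> kD kD' X Y; apply: pair_mulr2n_ker => Z.
  by rewrite pair_addl pair_oppl mulrnDl mulNrn kD kD' subrr.
split.
  split=> [[D kD] U UK X Y|gK]; first exact: koszul_lie_derivative kD UK.
  have [|x|D [_ kD]] := koszul_exists gK (C := fun x => fullv); last by exists D.
    exact: is_subbundle_fullv.
  by apply/addv_idPl/subvf.
move=> gK; split=> [D|//|C sC CK]; first exact: koszul_derivative_formula.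
have [x|D [DC kD]] := koszul_exists gK sC.
  by have [<- _] := CK x; rewrite addvC.
exists D; split=> // D' [kD' D'C]; apply/funext => X; apply/funext => Y.
apply: secP => x; apply/eqP; rewrite -subr_eq0 -memv0.
(* The difference lies in [C] by assumption and in the kernel by [uniq], and these meet only in
   0. *)
have [_ <-] := CK x; rewrite memv_cap; apply/andP; split; last first.
  exact: memvB (DC X Y x) (D'C X Y x).
have /(_ X Y x) :=
  uniq _ _ (koszul_derivative_formula kD) (koszul_derivative_formula kD').
by rewrite sec_subE.
Qed.
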